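(* Let $\gamma,\delta$ be constants (e.g. integers) and let the formal power series expansion of $$ \prod_{k\ge0}\left(1+\gamma x^{2^k-1}+\delta x^{2^k}\right) $$ be $a(0)+a(1)x+a(2)x^2+\cdots$. Then for all $n\ge0$, $$ a(n)=\sum_{m\ge0}\gamma^m\delta^{\mathrm{wt}(n+m)-m}\binom{\mathrm{wt}(n+m)}{m}. $$
   Context: $\mathrm{wt}(n)$ denotes the binary weight of $n$, i.e. the number of $1$'s in the binary expansion of $n$. The binomial coefficient $\binom{w}{m}$ is $0$ for $m>w$, so the sum has only finitely many nonzero terms. Note that the $k=0$ factor of the product is $1+\gamma+\delta x$. *)

(* Defs.v *)
From mathcomp Require Import all_boot all_algebra.
From mathcomp Require Import classical_sets cardinality fsbigop.

Set Implicit Arguments.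
Unset Strict Implicit.
Unset Printing Implicit Defensive.

Import GRing.Theory.
Local Open Scope ring_scope.

(* As n < 2 ^ n, the binary digits of n at positions i >= n are all 0. *)
Definition wt (n : nat) : nat :=
  count (fun i => odd (n %/ 2 ^ i)) (iota 0 n).

(* A formal power series is identified with its coefficient sequence, and the
   infinite product is the limit of the partial products in the 'X-adic
   topology: each coefficient is eventually constant. *)
Definition is_infprod (R : comNzRingType) (F : nat -> {poly R}) (a : nat -> R) :
    Prop :=
  forall n, exists K : nat, forall N : nat,
    (K <= N)%N -> (\prod_(k < N) F k)`_n = a n.

Definition factor (R : comNzRingType) (gamma delta : R) (k : nat) : {poly R} :=
  1 + gamma *: 'X^(2 ^ k - 1) + delta *: 'X^(2 ^ k).

Lemma is_infprod_unique (R : comNzRingType) (F : nat -> {poly R}) a b :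
  is_infprod F a -> is_infprod F b -> a =1 b.
Proof.
move=> Fa Fb n; have [K aK] := Fa n; have [L bL] := Fb n.
by rewrite -(aK (maxn K L)) ?leq_maxl // bL ?leq_maxr.
Qed.

Lemma is_infprod_factor (R : comNzRingType) (gamma delta : R) :
  exists a, is_infprod (factor gamma delta) a.
Proof.
exists (fun n => (\prod_(k < n.+1) factor gamma delta k)`_n) => n.
exists n.+1 => N /subnKC <-; elim: (N - n.+1)%N => [|d IHd]; first by rewrite addn0.
rewrite addnS big_ord_recr /= -IHd.
have lt_n : (n.+1 < 2 ^ (n.+1 + d))%N.
  by apply: leq_ltn_trans (leq_addr d n.+1) (ltn_expl _ _).
rewrite /factor -addrA mulrDr mulr1 coefD mulrDr -!scalerAr coefD !coefZ !coefMXn.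
by rewrite ltn_subRL add1n lt_n (ltn_trans _ lt_n) // !mulr0 !addr0.
Qed.

(* Main.v *)
Require Import Defs.
From mathcomp Require Import all_boot all_algebra.
From mathcomp Require Import classical_sets cardinality fsbigop.
From mathcomp Require Import zify ring.

Set Implicit Arguments.
Unset Strict Implicit.
Unset Printing Implicit Defensive.

Import GRing.Theory.
Local Open Scope classical_set_scope.
Local Open Scope ring_scope.

(* Multiplying each factor by 'X turns it into
   'X + 'X^(2 ^ k) * (gamma + delta 'X), so expanding the product of the
   first N factors over the subsets of {0, .., N - 1}, i.e. over the
   binary expansions of the j < 2 ^ N, gives
   \sum_(j < 2 ^ N) 'X^(j + N - wt j) * (gamma + delta 'X) ^+ wt j
   after multiplication by 'X^N. The coefficient of 'X^(n + N) is then
   read off with the binomial formula, the index j contributing the term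
   m = j - n. *)

(** Both windows of digit positions, of lengths [n] and [N], extend to length [n + N] by adding zero
    digits only. *)
Lemma wtE (N n : nat) :
  (n < 2 ^ N)%N -> wt n = (\sum_(0 <= i < N) odd (n %/ 2 ^ i))%N.
Proof.
have stable K d : (n < 2 ^ K)%N ->
    (\sum_(0 <= i < K + d) odd (n %/ 2 ^ i) =
     \sum_(0 <= i < K) odd (n %/ 2 ^ i))%N.
  move=> ltK; rewrite (big_cat_nat (leq0n K) (leq_addr d K)) /=.
  rewrite [X in (_ + X)%N]big_nat_cond [X in (_ + X)%N]big1 ?addn0 // => i.
  rewrite andbT => /andP[leKi _].
  by rewrite divn_small // (leq_trans ltK) // leq_exp2l.
have ltn : (n < 2 ^ n)%N by apply: ltn_expl.
move=> ltN; have -> : wt n = (\sum_(0 <= i < n) odd (n %/ 2 ^ i))%N.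
  rewrite /wt -sum1_count big_mkcond /index_iota subn0.
  by apply: eq_bigr => i _; case: odd.
by rewrite -(stable n N ltn) addnC (stable N n ltN).
Qed.

Lemma leq_wt (N n : nat) : (n < 2 ^ N)%N -> (wt n <= N)%N.
Proof.
move=> /wtE ->; rewrite -[leqRHS]muln1 -[X in (X * _)%N]subn0 -sum_nat_const_nat.
by apply: leq_sum => i _; apply: leq_b1.
Qed.

Lemma wt_addl_exp2 (N j : nat) : (j < 2 ^ N)%N -> wt (2 ^ N + j) = (wt j).+1.
Proof.
move=> ltj; have ltj1 : (2 ^ N + j < 2 ^ N.+1)%N.
  by rewrite expnS mul2n -addnn ltn_add2l.
rewrite (wtE ltj1) (wtE ltj) big_nat_recr //= divnDl ?dvdnn // divnn.
rewrite expn_gt0 /= divn_small // addn1; congr _.+1.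
rewrite big_nat [RHS]big_nat; apply: eq_bigr => i /andP[_ ltiN].
(* For [i < N] the quotient of [2 ^ N] by [2 ^ i] is even, so the added bit leaves digit [i]
   unchanged. *)
rewrite -{1}(subnK ltiN) addnS -addSn expnD divnDl ?dvdn_mull //.
by rewrite mulnK ?expn_gt0 // oddD oddX.
Qed.

(** This makes the sum over [m = j - n] finite, since ['C(wt j, m)] is then 0. If [L] is the
    position of the top bit of [j], then [wt j <= L + 1], and [n + L + 1 < 2 * L <= 2 ^ L <= j]
    because [L >= n + 2]. *)
Lemma wt_ltn_sub (n j : nat) : (2 ^ n.+2 <= j)%N -> (wt j < j - n)%N.
Proof.
move=> lej; have j0 : (0 < j)%N by apply: leq_trans lej; rewrite expn_gt0.
have /andP[leL ltL] := trunc_log_bounds (isT : 1 < 2)%N j0.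
set L := trunc_log 2 j in leL ltL.
have nL : (n.+2 <= L)%N.
  by rewrite /L -(trunc_expnK n.+2 (isT : 1 < 2)%N) leq_trunc_log.
rewrite (leq_ltn_trans (leq_wt ltL)) // ltn_subRL; apply: leq_trans leL.
case: L nL {ltL} => // L nL.
by have := ltn_expl L (isT : 1 < 2)%N; rewrite expnS; lia.
Qed.

Section PartialProducts.
Variables (R : comNzRingType) (gamma delta : R).

Lemma partial_prod_factor (N : nat) :
  'X^N * \prod_(k < N) factor gamma delta k =
  \sum_(0 <= j < 2 ^ N)
     'X^(j + (N - wt j)) * (gamma%:P + delta%:P * 'X) ^+ wt j.
Proof.
set q := gamma%:P + _.
have XfactorE k : 'X * factor gamma delta k = 'X + 'X^(2 ^ k) * q.
  rewrite /factor /q -!mul_polyC.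
  have -> : 'X^(2 ^ k) = 'X * 'X^(2 ^ k - 1) :> {poly R}.
    by rewrite -exprS subn1 prednK ?expn_gt0.
  by ring.
elim: N => [|N IHN].
  by rewrite big_ord0 big_nat1 /= !mulr1.
rewrite big_ord_recr /= exprSr mulrACA XfactorE IHN.
(* Split on bit [N] of the index: the summand ['X] of the new factor gives the [j < 2 ^ N], the
   summand ['X^(2 ^ N) * q] the indices [2 ^ N + j]. *)
rewrite mulrDr !mulr_suml [RHS](@big_cat_nat _ _ _ (2 ^ N)) ?leq_exp2l //=.
congr (_ + _).
  apply: eq_big_nat => j /andP[_ /leq_wt le_wt].
  by rewrite subSn // addnS exprSr; ring.
rewrite -{3}[(2 ^ N)%N]add0n big_addn expnS mul2n -addnn addnK.
apply: eq_big_nat => j /andP[_ ltj].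
rewrite [(j + 2 ^ N)%N]addnC wt_addl_exp2 // subSS -addnA.
by rewrite [in RHS]exprD [in RHS]exprSr; ring.
Qed.

Lemma coef_linear_exp (w i : nat) :
  ((gamma%:P + delta%:P * 'X) ^+ w)`_i =
  gamma ^+ (w - i) * delta ^+ i * 'C(w, i)%:R.
Proof.
have -> : (gamma%:P + delta%:P * 'X) ^+ w =
    \poly_(k < w.+1) (gamma ^+ (w - k) * delta ^+ k * 'C(w, k)%:R).
  rewrite exprDn poly_def; apply: eq_bigr => k _.
  rewrite exprMn -!polyC_exp mulrA -polyCM -mulr_natr -polyC_natr.
  by rewrite mulrAC -polyCM mul_polyC.
rewrite coef_poly ltnS; case: leqP => // /bin_small ->.
by rewrite mulr0.
Qed.

Lemma coef_partial_prod_factor (N n : nat) : (n <= 2 ^ N)%N ->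
  (\prod_(k < N) factor gamma delta k)`_n =
  \sum_(m < 2 ^ N - n)
    gamma ^+ m * delta ^+ (wt (n + m) - m) * 'C(wt (n + m), m)%:R.
Proof.
move=> len.
have := congr1 (fun p : {poly R} => p`_(n + N)) (partial_prod_factor N).
rewrite coefXnM ltnNge leq_addl addnK /= => ->.
(* The indices [j < n] contribute 0: the power of the linear polynomial would have to supply degree
   [n - j + wt j], above its exponent [wt j]. *)
rewrite coef_sum (@big_cat_nat _ _ _ n) //= [X in X + _]big_nat_cond big1.
  rewrite add0r -{1}[n]add0n big_addn big_mkord; apply: eq_bigr => m _.
  have /leq_wt le_wt : (n + m < 2 ^ N)%N by have := ltn_ord m; lia.
  rewrite [(m + n)%N]addnC coefXnM coef_linear_exp; set w := wt _ in le_wt *.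
  (* If [w < m], the monomial alone has degree above [n + N]; otherwise the coefficient of index
     [w - m] is read off and the symmetry of binomials applies. *)
  have [ltmw|lemw] := ltnP w m.
    by rewrite [in RHS]bin_small // ifT ?mulr0 //; lia.
  rewrite ifF; last by lia.
  have -> : (n + N - (n + m + (N - w)) = w - m)%N by lia.
  by rewrite subKn // bin_sub.
move=> j; rewrite andbT => /andP[_ ltj].
have /leq_wt le_wt : (j < 2 ^ N)%N by apply: leq_trans len.
rewrite coefXnM coef_linear_exp; case: ltnP => // _.
by rewrite bin_small ?mulr0 //; lia.
Qed.

End PartialProducts.

Theorem theorem8 (R : comNzRingType) (gamma delta : R) (a : nat -> R)
    (ha : is_infprod (factor gamma delta) a) (n : nat) :
  a n = \sum_(m \in [set: nat])
          gamma ^+ m * delta ^+ (wt (n + m) - m) * 'C(wt (n + m), m)%:R.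
Proof.
(* [N >= K] makes the coefficient stable; [N >= n + 2] makes every term with [m >= 2 ^ N - n]
   vanish. *)
have [K aK] := ha n; set N := maxn K n.+2.
have lenN : (2 ^ n.+2 <= 2 ^ N)%N by rewrite leq_exp2l // leq_maxr.
rewrite -(aK N (leq_maxl _ _)) coef_partial_prod_factor; last first.
  by apply: leq_trans lenN; have := ltn_expl n.+2 (isT : 1 < 2)%N; lia.
pose f m := gamma ^+ m * delta ^+ (wt (n + m) - m) * 'C(wt (n + m), m)%:R.
rewrite (fsbig_ord _ _ f).
apply: fsbig_widen => // m [_ /negP]; rewrite -leqNgt => lem.
have /wt_ltn_sub : (2 ^ n.+2 <= n + m)%N by lia.
by rewrite addKn => ltw; rewrite /= /f bin_small ?mulr0.
Qed.
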